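(* Let $d\ge 1$ be an integer and let $f_0,\ldots,f_d:[0,1]^{d+1}\to\mathbb{R}$ be continuous functions. Assume there is a function $\Phi:\mathcal{S}_d\to\mathbb{R}$ which is continuously differentiable on the interior of $\mathcal{S}_d$, whose gradient has a continuous extension to $\mathcal{S}_d$ (still denoted $\nabla\Phi$), and such that $$\forall\, v\in\mathcal{S}_d,\qquad \nabla\Phi(v)=\bigl(f_i(\tilde v)-f_0(\tilde v)\bigr)_{1\le i\le d}.$$ For every $u=(u_0,\ldots,u_d)\in\mathcal{P}_{d+1}$ set $q(u):=\sum_{i=0}^{d}u_i f_i(u)$, and let $Q^*:=\max\{q(u):u\in\mathcal{P}_{d+1}\}$. Let $\bar x_0\in\mathcal{P}_{d+1}$ be an arbitrary starting distribution. Then: (1) For every strategy $x\in\{0,1,\ldots,d\}^{\mathbb{N}^*}$, $Q(x)\le Q^*$. (2) For every strategy $x$ such that $\bar x_n\to\bar x_\infty$ as $n\to\infty$, $$\frac1n\sum_{k=1}^n f_{x_{k+1}}(\bar x_k)\longrightarrow q(\bar x_\infty)\quad\text{as } n\to\infty,$$ so that $Q(x)=q(\bar x_\infty)$. (3) In particular, there is no better strategy than choosing the player at random according to an i.i.d. strategy with distribution $\bar x^*\in\operatorname{argmax} q$: if $\bar x^*\in\mathcal{P}_{d+1}$ satisfies $q(\bar x^* )=Q^*$ and $X=(X_n)_{n\ge1}$ is a sequence of i.i.d. $\{0,\ldots,d\}$-valued random variables with distribution $\bar x^*$ (i.e. $\mathbb{P}(X_n=i)=\bar x^{*}_i$ for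 $i=0,\ldots,d$), then almost surely $Q(X)=Q^*$.
   Context: $\mathbb{N}^*=\{1,2,\ldots\}$. Notation: $\mathcal{S}_d:=\{v\in[0,1]^d:\sum_{i=1}^d v_i\le 1\}$ and $\mathcal{P}_{d+1}:=\{u=(u_0,\ldots,u_d)\in[0,1]^{d+1}:\sum_{i=0}^{d}u_i=1\}$. For $v=(v_1,\ldots,v_d)\in\mathcal{S}_d$, set $\tilde v:=(1-\sum_{i=1}^d v_i,\,v_1,\ldots,v_d)\in\mathcal{P}_{d+1}$. A strategy is a sequence $x=(x_n)_{n\ge1}\in\{0,\ldots,d\}^{\mathbb{N}^*}$. Given a strategy $x$, for $n\ge1$ set $\bar x_n:=(\bar x_n^0,\ldots,\bar x_n^d)$ with $\bar x_n^i:=\frac1n\sum_{k=1}^n\mathbf{1}_{\{x_k=i\}}$, $i=0,\ldots,d$; the vector $\bar x_0\in\mathcal{P}_{d+1}$ is a given starting distribution. The global cumulative worst payoff rate of $x$ is $$Q(x):=\liminf_{n\to+\infty}\frac1n\sum_{k=0}^{n-1}f_{x_{k+1}}(\bar x_k).$$ *)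

(* Defs.v *)
From HB Require Import structures.
From mathcomp Require Import all_boot all_order all_algebra.
From mathcomp Require Import finmap.
From mathcomp Require Import all_classical all_reals all_analysis.

Set Implicit Arguments.
Unset Strict Implicit.
Unset Printing Implicit Defensive.

Import Order.TTheory GRing.Theory Num.Theory.
Import numFieldNormedType.Exports.

Local Open Scope classical_set_scope.
Local Open Scope ring_scope.

(* The index sets {0, ..., d} and {1, ..., d} are 'I_d.+1 and 'I_d; the latter
   embeds in the former by lift ord0. *)

Definition unit_cube (R : realType) (n : nat) : set 'rV[R]_n :=
  [set u | forall i, 0 <= u ord0 i <= 1].

Definition subprob_simplex (R : realType) (d : nat) : set 'rV[R]_d :=
  [set v | unit_cube v /\ \sum_i v ord0 i <= 1].

Definition prob_simplex (R : realType) (d : nat) : set 'rV[R]_d.+1 :=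
  [set u | unit_cube u /\ \sum_i u ord0 i = 1].

Definition complete_prob (R : realType) (d : nat) (v : 'rV[R]_d) : 'rV[R]_d.+1 :=
  row_mx (const_mx (1 - \sum_i v ord0 i) : 'rV[R]_1) v.

Definition gradient (R : realType) (d : nat) (Phi : 'rV[R]_d -> R)
    (v : 'rV[R]_d) : 'rV[R]_d :=
  \row_i 'D_(delta_mx ord0 i) Phi v.

Definition continuously_differentiable_on (R : realType) (d : nat)
    (U : set 'rV[R]_d) (Phi : 'rV[R]_d -> R) : Prop :=
  (forall v, U v -> differentiable Phi v) /\
  {within U, continuous (gradient Phi)}.

(* A strategy (x_n)_(n >= 1) is a function x : nat -> 'I_d.+1 whose value at 0
   is never used. *)

Definition empirical_dist (R : realType) (d : nat) (x0 : 'rV[R]_d.+1)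
    (x : nat -> 'I_d.+1) (n : nat) : 'rV[R]_d.+1 :=
  if n == 0%N then x0
  else \row_i (n%:R^-1 * \sum_(1 <= k < n.+1) (x k == i)%:R).

(* The liminf is taken in the extended reals, so that no boundedness is
   presupposed; the term of index n = 0 is irrelevant. *)
Definition payoff_rate (R : realType) (d : nat)
    (f : 'I_d.+1 -> 'rV[R]_d.+1 -> R) (x0 : 'rV[R]_d.+1)
    (x : nat -> 'I_d.+1) : \bar R :=
  limn_einf (fun n : nat =>
    (n%:R^-1 * \sum_(0 <= k < n) f (x k.+1) (empirical_dist x0 x k))%:E).

Definition mean_payoff (R : realType) (d : nat)
    (f : 'I_d.+1 -> 'rV[R]_d.+1 -> R) (u : 'rV[R]_d.+1) : R :=
  \sum_i u ord0 i * f i u.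

Definition max_mean_payoff (R : realType) (d : nat)
    (f : 'I_d.+1 -> 'rV[R]_d.+1 -> R) : R :=
  sup [set mean_payoff f u | u in @prob_simplex R d].

(* Random variables with values in the finite set E, which carries the
   sigma-algebra of all its subsets. *)
Definition mutually_independent (R : realType) (disp : measure_display)
    (Omega : measurableType disp) (P : probability Omega R) (E : finType)
    (Y : nat -> Omega -> E) : Prop :=
  forall (J : {fset nat}) (B : nat -> set E),
    P (\bigcap_(n in [set` J]) Y n @^-1` B n) =
    (\prod_(n <- J) P (Y n @^-1` B n))%E.

Definition iid_with_law (R : realType) (disp : measure_display)
    (Omega : measurableType disp) (P : probability Omega R) (d : nat)
    (p : 'rV[R]_d.+1) (Y : nat -> Omega -> 'I_d.+1) : Prop :=
  [/\ forall n (B : set 'I_d.+1), measurable (Y n @^-1` B),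
      forall n i, P (Y n @^-1` [set i]) = (p ord0 i)%:E
    & mutually_independent P Y].

(* Main.v *)
(* With u_k the empirical distribution and e_i the i-th vertex of the simplex,
   (k + 1) (u_(k+1) - u_k) = e_(x_(k+1)) - u_k, so that
     f_(x_(k+1))(u_k) - q(u_k) = (k + 1) <grad Phi(v_k), v_(k+1) - v_k>
                               = (k + 1) (Phi(v_(k+1)) - Phi(v_k)) + o(1).
   By Abel summation the averaged payoff is, up to o(1), the mean of the q(u_k)
   plus the difference between Phi(v_n) and the mean of the Phi(v_k), k < n; for
   a bounded sequence such a difference has a nonpositive liminf, which gives (1).
   For (2) no potential is needed: f_i(u_k) may be replaced by its limit, and the
   proportion of the times at which i is played tends to the i-th coordinate of
   the limit. For (3), the strong law of large numbers reduces to (2). *)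
Require Import Defs.
From HB Require Import structures.
From mathcomp Require Import all_boot all_order all_algebra.
From mathcomp Require Import finmap.
From mathcomp Require Import all_classical all_reals all_analysis.
From mathcomp Require Import measurable_realfun zify ring lra.

Set Implicit Arguments.
Unset Strict Implicit.
Unset Printing Implicit Defensive.

Import Order.TTheory GRing.Theory Num.Theory.
Import numFieldNormedType.Exports.

Local Open Scope classical_set_scope.
Local Open Scope ring_scope.

(** * Uniform continuity, gaps to running means, approximate potentials *)

(** Heine-Cantor from the near-covering form of compactness: continuity at [x] with tolerance
    [e / 2] gives one radius valid for all points of [A] near [x], and compactness gives one valid
    on all of [A]. *)
Lemma compact_unif_continuous (R : realType) (V W : normedModType R)
    (A : set V) (f : V -> W) (e : R) :
  compact A -> {within A, continuous f} -> 0 < e ->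
  exists2 r, 0 < r & forall x y, A x -> A y -> `|x - y| < r ->
    `|f x - f y| < e.
Proof.
move=> /compact_near_coveringP/near_covering_withinP cA.
move=> /subspace_continuousP cf e0.
pose P (r : R) x := forall y, A y -> `|x - y| < r -> `|f x - f y| < e.
have : \forall r \near 0^'+, A `<=` P r.
  apply: cA => x Ax; rewrite /P.
  have e20 : 0 < e / 2 by rewrite divr_gt0.
  have /cvgrPdist_lt /(_ _ e20) := cf x Ax.
  rewrite /prop_near1 /within /= => /nbhs_ballP[r/= r0 xr].
  have {}xr z : `|x - z| < r -> A z -> `|f x - f z| < e / 2.
    by move=> xz; apply: xr; rewrite -ball_normE.
  near=> z s => Az y Ay zy.
  have xz : `|x - z| < r / 2.
    near: z; apply/nbhs_ballP; exists (r / 2) => /=; first by rewrite divr_gt0.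
    by move=> z; rewrite -ball_normE.
  have sr : s < r / 2 by near: s; apply: nbhs_right_lt; rewrite divr_gt0.
  have xy : `|x - y| < r.
    rewrite (splitr r) (le_lt_trans (ler_distD z _ _))// ltrD//.
    exact: lt_trans zy sr.
  rewrite (splitr e) (le_lt_trans (ler_distD (f x) _ _))// ltrD//.
    rewrite distrC; apply: xr => //.
    by rewrite (lt_trans xz)// ltr_pdivrMr// ltr_pMr// ltr1n.
  exact: xr.
move=> H; near (0:R)^'+ => r.
exists r; first by near: r; exact: nbhs_right_gt.
move=> x y Ax Ay; apply: (near H r) => //.
Unshelve. all: by end_near. Qed.

(* The means satisfy m_(n+1) - m_n = (a_n - m_n) / (n + 1), so a gap of size e
   would make them diverge like the harmonic series. *)
Lemma bounded_mean_gap (R : realType) (a : nat -> R) (M e : R) :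
  (forall n, `|a n| <= M) -> 0 < e ->
  ~ \forall n \near \oo, e <= a n - n%:R^-1 * \sum_(0 <= k < n) a k.
Proof.
move=> aM e0 [N _ HN]; apply: (@dvg_harmonic R).
pose m n := n%:R^-1 * \sum_(0 <= k < n) a k.
have M0 : 0 <= M by exact: le_trans (aM 0%N).
have mM n : `|m n| <= M.
  case: n => [|n]; first by rewrite /m invr0 mul0r normr0.
  rewrite /m normrM normfV normr_nat ler_pdivrMl//.
  rewrite (le_trans (ler_norm_sum _ _ _))//.
  rewrite (le_trans (ler_sum _ (fun i _ => aM i)))//.
  by rewrite sumr_const_nat subn0 mulr_natl.
have mS n : (0 < n)%N -> m n.+1 - m n = (a n - m n) / n.+1%:R.
  move=> n0; rewrite /m big_nat_recr//=.
  rewrite -natr1; field; rewrite natr1 !pnatr_eq0; lia.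
(* By [mS] and the gap, step [k] raises [m] by at least [e * harmonic k]. The sum starts at [N.+1]
   because [mS] needs a positive index. *)
have mlow p : m N.+1 + e * \sum_(N.+1 <= k < N.+1 + p) harmonic k <= m (N.+1 + p)%N.
  elim: p => [|p ih]; first by rewrite addn0 big_geq// mulr0 addr0.
  rewrite addnS big_nat_recr ?leq_addr//= mulrDr addrA.
  apply: (le_trans (lerD ih (lexx _))); rewrite -lerBrDl mS; last by lia.
  rewrite ler_pM2r ?invr_gt0//; apply: HN => /=; lia.
apply: nondecreasing_is_cvgn.
  by apply/nondecreasing_seqP => n; rewrite !seriesEnat/= big_nat_recr//= lerDl.
(* Two means differ by at most [2 * M], so by [mlow] the harmonic series gains at most [2 * M / e]
   after [N.+1]. *)
exists (series harmonic N.+1 + 2 * M / e) => _ [n _ <-].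
have [nN|Nn] := leqP n N.+1.
  apply: ler_wpDr; first by apply: divr_ge0; [exact: mulr_ge0|exact: ltW].
  by rewrite -subr_ge0 sub_series_geq// sumr_ge0// => k _; exact: harmonic_ge0.
rewrite -lerBlDl sub_series_geq ?(ltnW Nn)// ler_pdivlMr// mulrC.
have := mlow (n - N.+1)%N; rewrite subnKC ?(ltnW Nn)//.
have := mM n; have := mM N.+1; rewrite !ler_norml => /andP[h1 h2] /andP[h3 h4] h5.
lra.
Qed.

(* Phi need not extend to the boundary of K, so it is contracted towards the
   interior point c: Psi v = Phi ((1 - t) v + t c) / (1 - t), for a small t. *)
Lemma approx_potential (R : realType) (d : nat) (K : set 'rV[R]_d) (c : 'rV[R]_d)
    (Phi : 'rV[R]_d -> R) (G : 'rV[R]_d -> 'rV[R]_d) (e : R) :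
  compact K ->
  (forall u v (t : R), K u -> K v -> 0 <= t <= 1 -> K ((1 - t) *: u + t *: v)) ->
  interior K c ->
  (forall v, interior K v -> differentiable Phi v) ->
  (forall v, interior K v -> G v = gradient Phi v) ->
  {within K, continuous G} -> 0 < e ->
  exists2 Psi : 'rV[R]_d -> R, exists M, forall v, K v -> `|Psi v| <= M &
    exists2 r, 0 < r & forall v w, K v -> K w -> `|w - v| < r ->
      `|Psi w - Psi v - \sum_i G v ord0 i * (w ord0 i - v ord0 i)|
        <= e * `|w - v|.
Proof.
move=> cK convK intc dPhi GPhi cG e0.
have Kc : K c by exact: interior_subset intc.
(* The errors of the [d] coordinates add up, each at most [e'] times the norm of [w - v]; dividing
   by [d.+1] keeps [e'] positive when [d = 0]. *)
have [e' e'0 e'e] : exists2 e' : R, 0 < e' & e' * d%:R <= e.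
  exists (e / d.+1%:R); first by rewrite divr_gt0.
  rewrite mulrAC ler_pdivrMr// ler_pM2l// ler_nat; lia.
have [r r0 Gr] := compact_unif_continuous cK cG e'0.
have [B B0 KB] : exists2 B : R, 0 < B & forall v, K v -> `|c - v| < B.
  have /ex_strict_bound_gt0[B /= B0 HB] := compact_bounded cK.
  exists (`|c| + B) => [|v Kv]; first by rewrite ltr_wpDl.
  by rewrite (le_lt_trans (ler_normB _ _))// ltrD2l; exact: HB.
(* [t * B <= r / 2] lets the contraction move points of [K] by less than [r / 2]; [t < 1] makes
   [1 - t] invertible. *)
have [t [t0 t1 tr]] : exists t : R, [/\ 0 < t, t < 1 & t * B <= r / 2].
  exists (Num.min (1/2) (r / 2 / B)); split.
  - by rewrite lt_min !divr_gt0.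
  - by rewrite gt_min; apply/orP; left; lra.
  - by rewrite -ler_pdivlMr// ge_min lexx orbT.
pose h (v : 'rV[R]_d) : 'rV[R]_d := (1 - t) *: v + t *: c.
have Kh v : K v -> K (h v) by move=> Kv; apply: convK; rewrite // !ltW.
(* A point [w] close to [h v] is the same convex combination of [v] and a point of the ball around
   [c], so the ball of radius [t * s] around [h v] lies in [K]. *)
have hint v : K v -> interior K (h v).
  move=> Kv; have /nbhs_ballP[s/= s0 cs] : nbhs c K by [].
  apply/nbhs_ballP; exists (t * s) => /=; first by rewrite mulr_gt0.
  move=> w; rewrite -ball_normE/= => hw.
  rewrite (_ : w = (1 - t) *: v + t *: (c + t^-1 *: (w - h v))); last first.
    by rewrite scalerDr scalerA divff ?gt_eqF// scale1r /h addrA addrC subrK.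
  apply: convK => //; last by rewrite !ltW.
  apply: cs; rewrite -ball_normE/= opprD addrA subrr add0r normrN normrZ.
  by rewrite gtr0_norm ?invr_gt0// ltr_pdivrMl// distrC.
pose Psi v : R := (1 - t)^-1 * Phi (h v).
have hE v : h v - v = t *: (c - v).
  by rewrite /h scalerBl scale1r scalerBr addrAC (addrAC v) subrr add0r addrC.
have hnear v : K v -> `|h v - v| < r / 2.
  move=> Kv; rewrite hE normrZ gtr0_norm//; apply: lt_le_trans tr.
  by rewrite ltr_pM2l// KB.
(* Mean value theorem on the segment from [v] to [w]: the chain-rule factor [1 - t] cancels against
   the inverse factor in [Psi], so the gradient of [Psi] at [x] is [G (h x)]. *)
have h1 : forall v w, K v -> K w -> exists2 x, K x /\ `|x - v| <= `|w - v| &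
   Psi w - Psi v = \sum_i G (h x) ord0 i * (w ord0 i - v ord0 i).
  move=> v w Kv Kw.
  pose p (s : R) : 'rV[R]_d := (1 - s) *: v + s *: w.
  have Kp (s : R) : 0 <= s <= 1 -> K (p s) by exact: convK.
  pose u : 'rV[R]_d := (1 - t) *: (w - v).
  have hp s : h (p s) = s *: u + h v.
    rewrite /h /p /u; apply/rowP => i; rewrite !mxE; ring.
  pose g (s : R) : R := Phi (s *: u + h v).
  pose g' (s : R) : R := (1 - t) * \sum_i G (h (p s)) ord0 i * (w ord0 i - v ord0 i).
  have dg (s : R) : 0 <= s <= 1 -> is_derive s (1 : R) g (g' s).
    move=> s01; have ih := hint _ (Kp s s01).
    have dP := dPhi _ ih.
    have DE : 'D_u Phi (h (p s)) = g' s.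
      rewrite deriveE// [in LHS](row_sum_delta u) linear_sum /g' mulr_sumr.
      apply: eq_bigr => i _; rewrite linearZ /= -deriveE// GPhi// !mxE.
      by rewrite /GRing.scale/= mulrAC -mulrA.
    have := @diff_derivable _ _ _ Phi (h (p s)) u dP.
    rewrite /derivable => dd.
    have gE : (fun k : R => k^-1 *: ((g \o shift s) (k *: 1) - g s)) =
      (fun k : R => k^-1 *: ((Phi \o shift (h (p s))) (k *: u) - Phi (h (p s)))).
      apply/funext => k; rewrite /g /= hp; congr (_ *: (Phi _ - _)).
      by rewrite [k *: 1]mulr1 scalerDl -addrA.
    split; first by rewrite /derivable gE.
    by rewrite -DE /derive gE.
  have [s s01 sE] : exists2 s, s \in `[0, 1]%R & g 1 - g 0 = g' s * (1 - 0).
    apply: MVT_segment => //.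
      by move=> s; rewrite in_itv/= => /andP[s0 s1]; apply: dg; rewrite !ltW.
    have derg : {in `[0, 1]%R, forall s, derivable g s 1}.
      by move=> s; rewrite in_itv/= => /dg.
    by apply: derivable_within_continuous.
  rewrite in_itv/= in s01.
  exists (p s).
    split; first exact: Kp.
    rewrite (_ : p s - v = s *: (w - v)); last first.
      by rewrite /p scalerBl scale1r scalerBr addrAC (addrAC v) subrr add0r addrC.
    rewrite normrZ; case/andP: s01 => s0 s1.
    by rewrite ger0_norm// ler_piMl.
  rewrite /Psi -mulrBr.
  have -> : Phi (h w) = g 1.
    by rewrite /g -hp /p subrr scale0r add0r scale1r.
  have -> : Phi (h v) = g 0 by rewrite /g scale0r add0r.
  by rewrite sE subr0 mulr1 /g' mulKf// subr_eq0 gt_eqF.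
exists Psi.
  (* [Phi] is differentiable at every [h v], so [Psi] is continuous on the compact [K], boundary
     included, hence bounded. *)
  have cPsi : {within K, continuous Psi}.
    apply/subspace_continuousP => v Kv; apply: cvg_within_filter.
    apply: cvgM; first exact: cvg_cst.
    have hc : continuous h.
      move=> x; apply: continuousD; first exact: scaler_continuous.
      exact: cst_continuous.
    apply: (@continuous_comp _ _ _ h Phi); first exact: hc.
    by apply: differentiable_continuous; apply: dPhi; exact: hint.
  have /ex_strict_bound_gt0[M _ HM] :=
    compact_bounded (continuous_compact cPsi cK).
  by exists M => v Kv; apply/ltW/HM; exists v.
(* One half of [r] is for the distance from [v] to [x], the other for that from [x] to [h x]; then
   [G (h x)] is within [e'] of [G v]. *)
exists (r / 2); first by rewrite divr_gt0.
move=> v w Kv Kw wv; have [x [Kx xv] ->] := h1 _ _ Kv Kw.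
rewrite -sumrB (le_trans (ler_norm_sum _ _ _))//.
rewrite (@le_trans _ _ (\sum_(i < d) e' * `|w - v|))//; last first.
  by rewrite sumr_const card_ord -mulr_natr mulrAC ler_wpM2r.
have coordn (z : 'rV[R]_d) i : `|z ord0 i| <= `|z|.
  rewrite [leRHS]/Num.norm/= mx_normrE; apply/bigmax_geP; right.
  by exists (ord0, i).
apply: ler_sum => i _; rewrite -mulrBl normrM.
have := coordn (w - v) i; rewrite !mxE => wvi.
apply: ler_pM => //.
have := coordn (G (h x) - G v) i; rewrite !mxE => /le_trans; apply.
apply/ltW/Gr => //; first exact: Kh.
rewrite (le_lt_trans (ler_distD x _ _))// (splitr r) ltrD ?hnear//.
exact: le_lt_trans wv.
Qed.

(** * A strong law of large numbers for pairwise independent events *)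

(** An index from [m ^ 2] up to the next square lies at most [2 * m] steps after [m ^ 2], so [s]
    drifts by at most [2 * m], which is small against [m ^ 2]. *)
Lemma cvg_div_of_squares (R : realType) (s : nat -> R) :
  (forall n, `|s n.+1 - s n| <= 1) ->
  (fun m => ((m ^ 2)%N%:R)^-1 * s (m ^ 2)%N) @ \oo --> 0 ->
  (fun n => n%:R^-1 * s n) @ \oo --> 0.
Proof.
move=> s1 /cvgrPdist_lt s0; apply/cvgrPdist_lt => e e0.
have e20 : 0 < e / 2 by rewrite divr_gt0.
have [M _ HM] := s0 _ e20.
(* [m > 2 / (e / 2)] gives [2 * m <= e / 2 * m ^ 2]: one half of [e] pays for the value at the
   square, the other for the drift. *)
pose m0 := maxn M (Num.truncn (2 / (e / 2))).+1.
exists (m0 ^ 2)%N => // n /= m0n.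
have [m /andP[m1 m2]] : exists m, (m ^ 2 <= n < m.+1 ^ 2)%N.
  have ex : exists m, (m ^ 2 <= n)%N by exists m0.
  have ub m : (m ^ 2 <= n)%N -> (m <= n)%N by nia.
  exists (ex_maxn ex ub); case: ex_maxnP => i -> imax /=.
  by rewrite ltnNge; apply/negP => /imax; rewrite ltnn.
have m0m : (m0 <= m)%N by rewrite -ltnS -(@ltn_exp2r _ _ 2)// (leq_ltn_trans m0n).
have Mm : (M <= m)%N by rewrite (leq_trans _ m0m)// leq_maxl.
have em : 2 / (e / 2) < m%:R.
  rewrite (lt_le_trans (truncnS_gt _))// ler_nat (leq_trans _ m0m)// leq_maxr//.
have mpos : 0 < m%:R :> R by apply: lt_trans em; rewrite divr_gt0.
have mgt0 : (0 < m)%N by rewrite -(ltr0n R).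
have m2gt0 : 0 < (m ^ 2)%N%:R :> R by rewrite ltr0n expn_gt0 mgt0.
have npos : 0 < n%:R :> R by rewrite (lt_le_trans m2gt0)// ler_nat.
have sm : `|s (m ^ 2)%N| < e / 2 * (m ^ 2)%N%:R.
  have := HM m Mm; rewrite sub0r normrN normrM normfV normr_nat.
  by rewrite ltr_pdivrMl// mulrC.
have sl k : `|s (m ^ 2 + k)%N - s (m ^ 2)%N| <= k%:R.
  elim: k => [|k ih]; first by rewrite addn0 subrr normr0.
  rewrite addnS (le_trans (ler_distD (s (m ^ 2 + k)%N) _ _))//.
  by rewrite -natr1 addrC lerD.
rewrite sub0r normrN normrM normfV normr_nat ltr_pdivrMl//.
have := sl (n - m ^ 2)%N; rewrite subnKC// => snm.
have {}snm : `|s n - s (m ^ 2)%N| <= 2 * m%:R.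
  by rewrite (le_trans snm)// -natrM ler_nat; nia.
have : `|s n| <= `|s (m ^ 2)%N| + `|s n - s (m ^ 2)%N|.
  by rewrite -[X in `|X| <= _](subrKC (s (m ^ 2)%N)) ler_normD.
move=> h; apply: (@lt_le_trans _ _ (e * (m ^ 2)%N%:R)); last first.
  by rewrite mulrC ler_pM2r// ler_nat.
have : 2 * m%:R <= e / 2 * (m ^ 2)%N%:R.
  rewrite natrX expr2 mulrA ler_pM2r// mulrC -ler_pdivrMr//; exact: ltW.
lra.
Qed.

(** Integrating term by term, the sum of the [g n] has finite integral, so it is finite almost
    everywhere, and the terms of a convergent series tend to 0. *)
Lemma ae_cvg0_summable d (T : measurableType d) (R : realType)
    (mu : {measure set T -> \bar R}) (g : nat -> T -> R) :
  (forall n, measurable_fun setT (g n)) -> (forall n x, 0 <= g n x) ->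
  (\sum_(n <oo) \int[mu]_x (g n x)%:E < +oo)%E ->
  {ae mu, forall x, g ^~ x @ \oo --> 0}.
Proof.
move=> mg g0 sg.
have mEg n : measurable_fun setT (EFin \o g n).
  exact/measurable_EFinP.
pose F x := (\sum_(n <oo) (g n x)%:E)%E.
have F0 x : (0 <= F x)%E by apply: nneseries_ge0 => n _ _; rewrite lee_fin.
have intF : mu.-integrable setT F.
  apply/integrableP; split.
    by apply: ge0_emeasurable_sum => [n x _ _|n _]; [rewrite lee_fin|exact: mEg].
  under eq_integral do rewrite gee0_abs//.
  by rewrite integral_nneseries// => n x _; rewrite lee_fin.
apply: filterS (integrable_ae measurableT intF) => x /(_ Logic.I) Fx.
apply: cvg_series_cvg_0; apply: nondecreasing_is_cvgn.
  by apply/nondecreasing_seqP => n; rewrite !seriesEnat/= big_nat_recr//= lerDl.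
exists (fine (F x)) => _ [n _ <-].
rewrite -lee_fin fineK// seriesEnat/= -sumEFin.
by apply: nneseries_lim_ge => k _ _; rewrite lee_fin.
Qed.

(** The square expands into products of centred indicators: pairwise independence makes the
    off-diagonal ones integrate to 0, and each diagonal one gives the Bernoulli variance
    [p * (1 - p)]. *)
Lemma second_moment_indic d (T : measurableType d) (R : realType)
    (P : probability T R) (A : nat -> set T) (p : R) (n : nat) :
  (forall i, measurable (A i)) -> (forall i, P (A i) = p%:E) ->
  (forall i j, i != j -> P (A i `&` A j) = (p * p)%:E) ->
  (\int[P]_w ((\sum_(0 <= k < n) (\1_(A k) w - p)) ^+ 2)%:E
    = (n%:R * (p * (1 - p)))%:E)%E.
Proof.
move=> mA PA PAA.
have intc (c : R) B : measurable B ->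
    P.-integrable setT (fun w => (c * \1_B w)%:E).
  move=> mB; under eq_fun do rewrite EFinM.
  by apply: integrableZl => //; exact: integrable_indic.
have Ec (c : R) B : measurable B ->
    (\int[P]_w (c * \1_B w)%:E = c%:E * P B)%E.
  move=> mB; under eq_integral do rewrite EFinM.
  rewrite integralZl//; last exact: integrable_indic.
  by rewrite integral_indic// setIT.
pose y i j w : R := (\1_(A i) w - p) * (\1_(A j) w - p).
have yE i j w : (y i j w)%:E = ((1 * \1_(A i `&` A j) w)%:E +
    ((- p * \1_(A i) w)%:E + ((- p * \1_(A j) w)%:E +
      (p * p * \1_setT w)%:E)))%E.
  by rewrite -!EFinD; congr EFin; rewrite /y indicI indicT/=; ring.
have inty i j : P.-integrable setT (fun w => (y i j w)%:E).
  have mAA := measurableI _ _ (mA i) (mA j).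
  under eq_fun do rewrite yE.
  by do 3 (apply: integrableD => //; try exact: intc).
have Ey i j : (\int[P]_w (y i j w)%:E = ((i == j)%:R * (p * (1 - p)))%:E)%E.
  have mAA := measurableI _ _ (mA i) (mA j).
  under eq_integral do rewrite yE.
  rewrite integralD//; [|exact: intc|]; last first.
    by do 2 (apply: integrableD => //; try exact: intc).
  rewrite integralD//; [|exact: intc|]; last first.
    by apply: integrableD => //; exact: intc.
  rewrite integralD//; [|exact: intc|exact: intc].
  rewrite !Ec// !PA probability_setT mule1.
  have [->|ij] := eqVneq i j.
    by rewrite setIid PA mul1r -!EFinM -!EFinD; congr EFin; ring.
  by rewrite PAA// mul0r -!EFinM -!EFinD; congr EFin; ring.
transitivity (\int[P]_w (\sum_(0 <= i < n) \sum_(0 <= j < n) (y i j w)%:E))%E.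
  apply: eq_integral => w _; rewrite expr2 mulr_suml -sumEFin.
  by apply: eq_bigr => i _; rewrite mulr_sumr -sumEFin.
rewrite integral_sum//; last by move=> i; exact: integrable_sum.
under eq_bigr => i _.
  rewrite integral_sum//; under eq_bigr do rewrite Ey.
  rewrite sumEFin -mulr_suml; over.
rewrite sumEFin -mulr_suml; congr ((_ * _)%:E).
rewrite (eq_big_nat _ _ (F2 := fun=> 1)) => [|i /andP[_ ni]].
  by rewrite sumr_const_nat subn0.
rewrite (bigD1_seq i) ?mem_index_iota ?iota_uniq//= eqxx big1 ?addr0// => j ji.
by rewrite eq_sym (negbTE ji).
Qed.

(* The mean squares of the centred averages are summable along the subsequence
   of the squares. *)
Lemma slln_indic d (T : measurableType d) (R : realType)
    (P : probability T R) (A : nat -> set T) (p : R) :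
  (forall i, measurable (A i)) -> (forall i, P (A i) = p%:E) ->
  (forall i j, i != j -> P (A i `&` A j) = (p * p)%:E) ->
  {ae P, forall w,
    (fun n => n%:R^-1 * \sum_(0 <= k < n) \1_(A k) w) @ \oo --> p}.
Proof.
move=> mA PA PAA.
pose s w n : R := \sum_(0 <= k < n) (\1_(A k) w - p).
pose sq m := (m.+1 ^ 2)%N.
pose g m w : R := ((sq m)%:R^-1 * s w (sq m)) ^+ 2.
have p01 : 0 <= p <= 1.
  by rewrite -!lee_fin -(PA 0%N) measure_ge0 probability_le1.
have ms n : measurable_fun setT (s ^~ n).
  apply: measurable_sum => k.
  by apply: measurable_funB => //; exact: measurable_indic.
have mg n : measurable_fun setT (g n).
  by apply: measurable_funX; apply: measurable_funM => //; exact: ms.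
(* The integral is [p * (1 - p)] over the square of [m.+1]; the telescoping bound, from
   [x + 1 <= 2 * x] for [x >= 1], makes the series sum to at most 2. *)
have Eg m : (\int[P]_w (g m w)%:E <= (2 * (m.+1%:R^-1 - m.+2%:R^-1))%:E)%E.
  have -> : (\int[P]_w (g m w)%:E = ((sq m)%:R^-1 ^+ 2)%:E *
      \int[P]_w (s w (sq m) ^+ 2)%:E)%E.
    rewrite -ge0_integralZl_EFin//.
    - by apply: eq_integral => w _; rewrite /g exprMn EFinM.
    - by move=> w _; rewrite lee_fin sqr_ge0.
    - by apply/measurable_EFinP; apply: measurable_funX; exact: ms.
  rewrite (second_moment_indic _ mA PA PAA) -EFinM lee_fin.
  rewrite /sq natrX; set x : R := m.+1%:R.
  have x1 : 1 <= x by rewrite ler1n.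
  have x0 : 0 < x by rewrite (lt_le_trans ltr01).
  rewrite (_ : m.+2%:R = x + 1); last by rewrite natr1.
  have -> : (x ^+ 2)^-1 ^+ 2 * (x ^+ 2 * (p * (1 - p))) =
      (p * (1 - p)) / x ^+ 2.
    by field; rewrite gt_eqF.
  have -> : 2 * (x^-1 - (x + 1)^-1) = 2 / (x * (x + 1)).
    by field; rewrite !gt_eqF// addr_gt0.
  have x10 : 0 < x + 1 by rewrite addr_gt0.
  rewrite ler_pdivrMr ?exprn_gt0// mulrAC ler_pdivlMr ?mulr_gt0//.
  case/andP: p01 => p0 p1.
  have : p * (1 - p) <= 1 by nra.
  nra.
have sg : (\sum_(n <oo) \int[P]_w (g n w)%:E < +oo)%E.
  apply: (@le_lt_trans _ _ 2%:E); last by rewrite ltry.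
  apply: lime_le.
    apply: is_cvg_nneseries => n _ _.
    by apply: integral_ge0 => w _; rewrite lee_fin sqr_ge0.
  apply: nearW => n; apply: (le_trans (lee_sum _ (fun k _ => Eg k))).
  rewrite sumEFin lee_fin -mulr_sumr ger_pMr//.
  rewrite -[leLHS]opprK -sumrN (eq_bigr (fun k => k.+2%:R^-1 - k.+1%:R^-1)) => [|k _].
    rewrite (telescope_sumr (fun k => k.+1%:R^-1))// invr1 opprB gerBl.
    by rewrite invr_ge0.
  by rewrite opprB.
have := ae_cvg0_summable mg (fun n w => sqr_ge0 _) sg.
apply: filterS => w /= gw.
have sq0 : (fun m => (sq m)%:R^-1 * s w (sq m)) @ \oo --> (0 : R).
  apply/cvgrPdist_lt => e e0.
  have e20 : 0 < e ^+ 2 by rewrite exprn_gt0.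
  move/cvgrPdist_lt : gw => /(_ _ e20); apply: filterS => m.
  rewrite !sub0r !normrN /g normrX ltr_pXn2r// ?nnegrE// ltW//.
have {}sq0 : (fun m => ((m ^ 2)%N%:R)^-1 * s w (m ^ 2)%N) @ \oo --> (0 : R).
  by rewrite -(cvg_shiftS _).
have s1 n : `|s w n.+1 - s w n| <= 1.
  rewrite /s big_nat_recr//= addrAC subrr add0r ler_norml indicE.
  by case: (w \in A n) => /=; case/andP: p01 => p0 p1; apply/andP; split; lra.
have := cvg_div_of_squares s1 sq0 => h.
have hp : (fun n => n%:R^-1 * s w n + p) @ \oo --> p.
  by rewrite -[X in _ --> X]add0r; apply: cvgD; [exact: h|exact: cvg_cst].
apply: cvg_trans hp; apply: near_eq_cvg; near=> n.
have n0 : n%:R != 0 :> R.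
  rewrite pnatr_eq0 -lt0n; near: n; exact: nbhs_infty_gt.
rewrite /s/= sumrB sumr_const_nat subn0 -[p *+ n]mulr_natl mulrBr mulKf//.
by rewrite subrK.
Unshelve. all: by end_near. Qed.

(** * Geometry of the simplices *)

Lemma complete_prob0 (R : realType) (d : nat) (v : 'rV[R]_d) :
  complete_prob v ord0 ord0 = 1 - \sum_i v ord0 i.
Proof.
rewrite (_ : ord0 = lshift d (ord0 : 'I_1) :> 'I_(1 + d)); last exact: val_inj.
by apply: etrans (row_mxEl _ _ _ _) _; rewrite mxE.
Qed.

Lemma complete_prob_lift (R : realType) (d : nat) (v : 'rV[R]_d) (i : 'I_d) :
  complete_prob v ord0 (lift ord0 i) = v ord0 i.
Proof. by rewrite -rshift1; apply: etrans (row_mxEr _ _ _ _) _. Qed.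

Lemma complete_prob_tail (R : realType) (d : nat) (u : 'rV[R]_d.+1) :
  \sum_i u ord0 i = 1 -> complete_prob (\row_i u ord0 (lift ord0 i)) = u.
Proof.
rewrite big_ord_recl => u1; apply/rowP => i.
have [j ->|->] := unliftP ord0 i; first by rewrite complete_prob_lift mxE.
rewrite complete_prob0; under eq_bigr do rewrite mxE.
by rewrite -u1 addrK.
Qed.

Lemma subprob_simplex_tail (R : realType) (d : nat) (u : 'rV[R]_d.+1) :
  prob_simplex u -> subprob_simplex (\row_i u ord0 (lift ord0 i)).
Proof.
move=> [u01 u1]; split=> [i|]; first by rewrite mxE; exact: u01.
under eq_bigr do rewrite mxE.
by rewrite -u1 big_ord_recl lerDr; case/andP: (u01 ord0).
Qed.

Lemma compact_unit_cube (R : realType) (n : nat) : compact (@unit_cube R n).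
Proof.
have := @rV_compact R n (fun=> `[0, 1]%classic) (fun=> @segment_compact R 0 1).
by congr compact; apply/seteqP; split=> v /= vi i; have := vi i; rewrite in_itv.
Qed.

Lemma continuous_sum_coord (R : realType) (n : nat) :
  continuous (fun u : 'rV[R]_n => \sum_i u ord0 i).
Proof.
apply: (@continuous_big _ _ +%R) => [|i _]; first exact: add_continuous.
exact: coord_continuous.
Qed.

Lemma compact_prob_simplex (R : realType) (d : nat) :
  compact (@prob_simplex R d).
Proof.
apply: (@subclosed_compact _ _ (@unit_cube R d.+1)).
- have -> : @prob_simplex R d = @unit_cube R d.+1 `&`
    (fun u : 'rV[R]_d.+1 => \sum_i u ord0 i) @^-1` [set 1] by [].
  apply: closedI; first exact: compact_closed (@norm_hausdorff _ _) (@compact_unit_cube R _).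
  apply: preimage_closed; last exact: closed_eq.
  by move=> u _; exact: continuous_sum_coord.
- exact: compact_unit_cube.
- by move=> u [].
Qed.

Lemma compact_subprob_simplex (R : realType) (d : nat) :
  compact (@subprob_simplex R d).
Proof.
apply: (@subclosed_compact _ _ (@unit_cube R d)).
- have -> : @subprob_simplex R d = @unit_cube R d `&`
    (fun u : 'rV[R]_d => \sum_i u ord0 i) @^-1` [set x | x <= 1] by [].
  apply: closedI; first exact: compact_closed (@norm_hausdorff _ _) (@compact_unit_cube R _).
  apply: preimage_closed; last exact: closed_le.
  by move=> u _; exact: continuous_sum_coord.
- exact: compact_unit_cube.
- by move=> u [].
Qed.

Lemma convex_subprob_simplex (R : realType) (d : nat) (u v : 'rV[R]_d) (t : R) :
  subprob_simplex u -> subprob_simplex v -> 0 <= t <= 1 ->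
  subprob_simplex ((1 - t) *: u + t *: v).
Proof.
move=> [u01 u1] [v01 v1] /andP[t0 t1]; split=> [i|].
  rewrite !mxE; have /andP[? ?] := u01 i; have /andP[? ?] := v01 i.
  by apply/andP; split; nra.
under eq_bigr do rewrite !mxE.
rewrite big_split/= -!mulr_sumr; nra.
Qed.

(** Provides the centre of the contraction in [approx_potential]. *)
Lemma interior_subprob_simplex (R : realType) (d : nat) :
  exists c, interior (@subprob_simplex R d) c.
Proof.
(* Coordinates within [r] of the centre lie between 0 and [2 * r], and [d] times [2 * r] is
   [d / (d + 1)], at most 1. *)
pose r : R := (2 * d.+1%:R)^-1.
have r0 : 0 < r by rewrite invr_gt0 mulr_gt0.
exists (const_mx r); apply/nbhs_ballP; exists r => //= v [_ rv].
have {}rv i : 0 <= v ord0 i <= 2 * r.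
  have := rv ord0 i; rewrite -ball_normE /= mxE ltr_norml => /andP[? ?].
  by apply/andP; split; lra.
have rd : d%:R * (2 * r) <= 1.
  rewrite /r invfM mulVKf// ler_pdivrMr// mul1r ler_nat; lia.
split=> [i|].
  have /andP[-> /le_trans]/= := rv i; apply; apply: le_trans rd.
  rewrite ler_peMl//; first by rewrite mulr_ge0// ltW.
  by rewrite ler1n; case: i => m /=; lia.
apply: le_trans rd.
apply: (@le_trans _ _ (\sum_(i < d) 2 * r)).
  by apply: ler_sum => i _; case/andP: (rv i).
by rewrite sumr_const card_ord -[leLHS]mulr_natl.
Qed.

(** * Empirical distributions and the payoff of one step *)

Lemma empirical_distS (R : realType) (d : nat)
    (x0 : 'rV[R]_d.+1) (x : nat -> 'I_d.+1) n i :
  n.+1%:R * (empirical_dist x0 x n.+1 ord0 i - empirical_dist x0 x n ord0 i) =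
  (x n.+1 == i)%:R - empirical_dist x0 x n ord0 i.
Proof.
rewrite mulrBr [in X in X - _]/empirical_dist/= mxE mulVKf// big_nat_recr//=.
(* At [n = 0] the start [x0] is not an average, but the distribution at time 1 is the vertex of the
   first player, and the identity still holds. *)
case: n => [|n]; first by rewrite big_nil add0r mul1r.
rewrite /empirical_dist/= mxE; set S := \sum_(_ <= _ < _) _.
rewrite -[n.+2%:R]natr1; set y := n.+1%:R.
have y0 : y != 0 by rewrite /y.
by field.
Qed.

Lemma empirical_dist_simplex (R : realType) (d : nat)
    (x0 : 'rV[R]_d.+1) (x : nat -> 'I_d.+1) n :
  prob_simplex x0 -> prob_simplex (empirical_dist x0 x n).
Proof.
move=> hx0.
case: n => [|n]; first by [].
split=> [i|].
  rewrite mxE mulr_ge0 ?sumr_ge0//= ler_pdivrMl// mulr1.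
  apply: (@le_trans _ _ (\sum_(1 <= k < n.+2) 1)).
    by apply: ler_sum => k _; rewrite lern1 leq_b1.
  by rewrite sumr_const_nat subSS subn0.
under eq_bigr do rewrite mxE.
rewrite -mulr_sumr exchange_big/= (eq_bigr (fun=> 1)) => [|k _].
  by rewrite sumr_const_nat subSS subn0 mulVf.
by rewrite (bigD1 (x k))//= eqxx big1 ?addr0// => i /negbTE; rewrite eq_sym => ->.
Qed.

(** The increments of the empirical distribution sum to 0, so [f ord0] can be subtracted from every
    payoff; the differences left are the coordinates of the gradient of the potential. *)
Lemma payoff_gap (R : realType) (d : nat)
    (x0 : 'rV[R]_d.+1) (x : nat -> 'I_d.+1)
    (f : 'I_d.+1 -> 'rV[R]_d.+1 -> R) n :
  prob_simplex x0 ->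
  let u := empirical_dist x0 x in
  f (x n.+1) (u n) - mean_payoff f (u n) =
  n.+1%:R * \sum_(i < d) (f (lift ord0 i) (u n) - f ord0 (u n)) *
    (u n.+1 ord0 (lift ord0 i) - u n ord0 (lift ord0 i)).
Proof.
move=> hx0 u; have Su k := empirical_dist_simplex x k hx0.
pose D i := n.+1%:R * (u n.+1 ord0 i - u n ord0 i).
have D0 : \sum_i D i = 0.
  rewrite -mulr_sumr sumrB.
  by rewrite !(proj2 (Su _)) subrr mulr0.
transitivity (\sum_i f i (u n) * D i).
  rewrite /D; under eq_bigr do rewrite empirical_distS mulrBr.
  rewrite sumrB; congr (_ - _); last by apply: eq_bigr => i _; rewrite mulrC.
  rewrite (bigD1 (x n.+1))//= eqxx mulr1 big1 ?addr0// => i /negbTE.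
  by rewrite eq_sym => ->; rewrite mulr0.
transitivity (\sum_i (f i (u n) - f ord0 (u n)) * D i).
  under [RHS]eq_bigr do rewrite mulrBl.
  by rewrite sumrB -mulr_sumr D0 mulr0 subr0.
rewrite big_ord_recl subrr mul0r add0r mulr_sumr.
by apply: eq_bigr => i _; rewrite /D mulrCA.
Qed.

(** * The upper bound on the payoff rate *)

(** If a tail infimum exceeded [l + e], the sequence would eventually stay above [l + e]. The
    negated hypothesis matches the conclusion of [bounded_mean_gap]. *)
Lemma limn_einf_le (R : realType) (u : nat -> R) (l : R) :
  (forall e, 0 < e -> ~ \forall n \near \oo, l + e <= u n) ->
  (limn_einf (EFin \o u) <= l%:E)%E.
Proof.
move=> ul; apply/lee_addgt0Pr => e e0; rewrite limn_einf_lim.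
apply: lime_le; first exact: is_cvg_einfs.
apply: nearW => N; rewrite leNgt; apply/negP => lN.
apply: (ul e e0); exists N => // n /= Nn.
rewrite -lee_fin EFinD; apply: le_trans (ltW lN) _.
by apply: ereal_inf_lbound; exists n.
Qed.

Lemma compact_max_mean_payoff (R : realType) (d : nat)
    (f : 'I_d.+1 -> 'rV[R]_d.+1 -> R) (u0 : 'rV[R]_d.+1) :
  prob_simplex u0 -> (forall i, {within @unit_cube R d.+1, continuous (f i)}) ->
  (exists2 u, prob_simplex u & mean_payoff f u = max_mean_payoff f) /\
  (forall u, prob_simplex u -> mean_payoff f u <= max_mean_payoff f).
Proof.
move=> hu0 cf.
have cq : {within @prob_simplex R d, continuous (mean_payoff f)}.
  have sub : @prob_simplex R d `<=` @unit_cube R d.+1 by move=> u [].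
  apply/subspace_continuousP => u Su.
  apply: (@cvg_big _ _ +%R) => [|i _]; first exact: add_continuous.
  apply: cvgM; first by apply: cvg_within_filter; exact: coord_continuous.
  have /subspace_continuousP/(_ u Su) := continuous_subspaceW sub (cf i).
  exact.
have S0 : @prob_simplex R d !=set0 by exists u0.
have [c cS cmax] := EVT_max_rV S0 (@compact_prob_simplex R d) cq.
rewrite inE in cS.
have ub : ubound [set mean_payoff f u | u in @prob_simplex R d] (mean_payoff f c).
  by move=> _ [u Su <-]; apply: cmax; rewrite inE.
have le u : prob_simplex u -> mean_payoff f u <= max_mean_payoff f.
  by move=> Su; apply: ub_le_sup; [exists (mean_payoff f c)|exists u].
split=> //; exists c => //; apply/eqP; rewrite eq_le le//=.
by apply: ge_sup => //; exists (mean_payoff f c), c.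
Qed.

Lemma payoff_rate_le (R : realType) (d : nat)
    (f : 'I_d.+1 -> 'rV[R]_d.+1 -> R) (Phi : 'rV[R]_d -> R)
    (G : 'rV[R]_d -> 'rV[R]_d) (q : R) (x0 : 'rV[R]_d.+1) (x : nat -> 'I_d.+1) :
  (forall v, interior (@subprob_simplex R d) v -> differentiable Phi v) ->
  (forall v, interior (@subprob_simplex R d) v -> G v = gradient Phi v) ->
  {within @subprob_simplex R d, continuous G} ->
  (forall v, subprob_simplex v -> forall i : 'I_d, G v ord0 i =
        f (lift ord0 i) (complete_prob v) - f ord0 (complete_prob v)) ->
  prob_simplex x0 -> (forall u, prob_simplex u -> mean_payoff f u <= q) ->
  (payoff_rate f x0 x <= q%:E)%E.
Proof.
move=> dPhi GPhi cG Gf hx0 fq.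
apply: limn_einf_le => e3 e30.
(* One [e] covers the error of the approximate potential, one the finitely many early steps, and the
   last remains as the gap that [bounded_mean_gap] excludes. *)
have [e e0 e3E] : exists2 e, 0 < e & e3 = 3 * e.
  by exists (e3 / 3); [rewrite divr_gt0|rewrite mulrC divfK].
have [c intc] := interior_subprob_simplex R d.
have [Psi [M PsiM] [r r0 Psir]] := approx_potential
  (@compact_subprob_simplex R d) (@convex_subprob_simplex R d) intc dPhi GPhi
  cG e0.
pose u := empirical_dist x0 x.
pose v n : 'rV[R]_d := \row_i u n ord0 (lift ord0 i).
have vE n i : v n ord0 i = u n ord0 (lift ord0 i) by exact: mxE.
have Su n : prob_simplex (u n) by exact: empirical_dist_simplex.
have Sv n : subprob_simplex (v n) by exact: subprob_simplex_tail.
have uv n : complete_prob (v n) = u n.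
  by apply: complete_prob_tail; case: (Su n).
pose pay k := f (x k.+1) (u k).
pose a n := Psi (v n).
(* By [empirical_distS], [n.+1] times the increment of each coordinate lies in [[-1, 1]]; the norm
   is the largest coordinate. *)
have vS n : `|v n.+1 - v n| <= n.+1%:R^-1.
  rewrite [leLHS]/Num.norm/= mx_normrE; apply/bigmax_leP.
  split=> [|[j i] _]; first by rewrite invr_ge0.
  pose z := u n.+1 ord0 (lift ord0 i) - u n ord0 (lift ord0 i).
  rewrite (_ : (v n.+1 - v n) _ _ = z); last first.
    by rewrite mxE [X in _ + X]mxE; congr (_ - _); exact: mxE.
  rewrite -[z](@mulKf _ n.+1%:R) ?pnatr_eq0// normrM normfV normr_nat.
  rewrite ler_piMr ?invr_ge0// /z empirical_distS -/u.
  have /andP[? ?] := (Su n).1 (lift ord0 i).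
  rewrite ler_norml; case: (_ == _) => /=; apply/andP; split; lra.
(* The potential estimate errs by at most [e / n.+1] here, so multiplying by [n.+1] leaves an error
   of at most [e]. *)
have step n : n.+1%:R^-1 < r -> pay n <= q + n.+1%:R * (a n.+1 - a n) + e.
  move=> nr; have := payoff_gap x f n hx0; rewrite /= -/u.
  set D := \sum_(i < d) _ => pE.
  have DE : D = \sum_i G (v n) ord0 i * (v n.+1 ord0 i - v n ord0 i).
    by apply: eq_bigr => i _; rewrite Gf// uv !vE.
  have /(_ _)/ler_normlP[] := Psir _ _ (Sv n) (Sv n.+1).
    exact: le_lt_trans (vS n) nr.
  rewrite -DE -/(a n) -/(a n.+1) => h1 _.
  have n0 : 0 < n.+1%:R :> R by [].
  have h2 : e * `|v n.+1 - v n| <= e * n.+1%:R^-1 by rewrite ler_pM2l.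
  have : n.+1%:R * D <= n.+1%:R * (a n.+1 - a n + e * n.+1%:R^-1).
    have aux (b b' y z : R) : - (b - b' - y) <= z -> y <= b - b' + z by lra.
    by rewrite ler_pM2l//; exact: aux (le_trans h1 h2).
  rewrite mulrDr (mulrCA _ e) divff ?pnatr_eq0// mulr1 -pE.
  have := fq _ (Su n); rewrite /pay; lra.
have [N HN] : exists N, forall n, (N <= n)%N -> n.+1%:R^-1 < r.
  have /cvgrPdist_lt/(_ _ r0)[N _ HN] := @cvg_harmonic R.
  exists N => n /HN /=; rewrite sub0r normrN ger0_norm ?harmonic_ge0//.
(* From [N] on, [step] makes [gap] nonpositive, so its partial sums never exceed the constant [C]
   set by the first [N] terms. *)
pose gap k := pay k - (q + k.+1%:R * (a k.+1 - a k) + e).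
pose C := \sum_(0 <= k < N) `|gap k|.
have gapC n : \sum_(0 <= k < n) gap k <= C.
  elim: n => [|n ih]; first by rewrite big_nil sumr_ge0.
  have [nN|Nn] := ltnP n N.
    rewrite /C [leRHS](big_cat_nat (n := n.+1))//=.
    apply: ler_wpDr; first by rewrite sumr_ge0.
    by apply: ler_sum => k _; exact: ler_norm.
  rewrite big_nat_recr//= -[leRHS]addr0 lerD//.
  by rewrite subr_le0; apply: step; exact: HN.
(* Abel summation: after division by [n] this is [a n] minus the mean of the earlier values, the
   quantity in [bounded_mean_gap]. *)
have abel n : \sum_(0 <= k < n) (k.+1%:R * (a k.+1 - a k)) =
    n%:R * a n - \sum_(0 <= k < n) a k.
  elim: n => [|n ih]; first by rewrite !big_nil mul0r subr0.
  by rewrite !big_nat_recr//= ih -natr1; ring.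
move=> nearq; apply: (@bounded_mean_gap R a M e) => //.
  by move=> n; exact: PsiM.
have C0 : 0 <= C by exact: sumr_ge0.
have nearC : \forall n \near \oo, C / n%:R <= e.
  exists (Num.truncn (C / e)).+1 => // n /= Cn.
  have n0 : 0 < n%:R :> R by rewrite ltr0n; exact: leq_trans Cn.
  rewrite ler_pdivrMr// mulrC -ler_pdivrMr//.
  rewrite (le_trans (ltW (truncnS_gt _)))// ler_nat//.
near=> n.
have n0 : 0 < n%:R :> R by rewrite ltr0n; near: n; exact: nbhs_infty_gt.
have h1 : q + e3 <= n%:R^-1 * \sum_(0 <= k < n) pay k by near: n.
have h2 : C / n%:R <= e by near: n.
have := gapC n; rewrite /gap sumrB 2!big_split/= abel !sumr_const_nat subn0.
rewrite -[q *+ n]mulr_natl -[e *+ n]mulr_natl.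
rewrite -(ler_pM2l (x := n%:R^-1)) ?invr_gt0// !(mulrDr, mulrN) !mulKf ?gt_eqF//.
rewrite (mulrC _ C) => h3.
lra.
Unshelve. all: by end_near. Qed.

(** * Convergent and i.i.d. strategies *)

Lemma mean_payoff_cvg (R : realType) (d : nat)
    (f : 'I_d.+1 -> 'rV[R]_d.+1 -> R) (x0 : 'rV[R]_d.+1) (x : nat -> 'I_d.+1)
    (xinf : 'rV[R]_d.+1) :
  (forall i, {within @unit_cube R d.+1, continuous (f i)}) -> prob_simplex x0 ->
  empirical_dist x0 x @ \oo --> xinf ->
  (fun n => n%:R^-1 * \sum_(0 <= k < n) f (x k.+1) (empirical_dist x0 x k))
    @ \oo --> mean_payoff f xinf.
Proof.
move=> cf hx0 ux; pose u := empirical_dist x0 x.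
have Cu n : unit_cube (u n) by case: (empirical_dist_simplex x n hx0).
(* The cube is closed, so the limit stays where the [f i] are continuous. *)
have Cinf : unit_cube xinf.
  have cl := compact_closed (@norm_hausdorff _ _) (@compact_unit_cube R d.+1).
  apply: (@closed_cvg _ _ \oo _ u _ cl _ _ ux).
  by apply: nearW => n; exact: Cu.
pose b k := f (x k.+1) (u k) - f (x k.+1) xinf.
have b0 : b @ \oo --> 0.
  apply/cvgrPdist_lt => e e0.
  have fi i : \forall n \near \oo, `|f i xinf - f i (u n)| < e.
    have /subspace_continuousP/(_ _ Cinf)/cvgrPdist_lt/(_ _ e0) := cf i.
    rewrite /prop_near1 /within/= => H.
    have {}H : \forall n \near \oo, unit_cube (u n) -> `|f i xinf - f i (u n)| < e.
      exact: ux _ H.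
    by apply: filterS H => n; exact.
  (* There are finitely many players, so one rank serves all [i], hence also the player [x n.+1],
     which varies with [n]. *)
  have : \forall n \near \oo, forall i, `|f i xinf - f i (u n)| < e.
    exact: filter_forall.
  by apply: filterS => n /(_ (x n.+1)); rewrite sub0r opprB.
rewrite -cvg_shiftS /=.
have -> : (fun n => n.+1%:R^-1 * \sum_(0 <= k < n.+1) f (x k.+1) (u k)) =
    (fun n => arithmetic_mean b n + \sum_i u n.+1 ord0 i * f i xinf).
  apply/funext => n; rewrite /arithmetic_mean/= seriesEnat/=.
  (* Grouping the times by the player chosen turns the average of [f (x k.+1) xinf] into a sum
     weighted by frequencies. *)
  have -> : \sum_i u n.+1 ord0 i * f i xinf =
      n.+1%:R^-1 * \sum_(0 <= k < n.+1) f (x k.+1) xinf.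
    under eq_bigr do rewrite mxE -mulrA mulr_suml.
    rewrite -mulr_sumr; congr (_ * _); rewrite exchange_big/= big_add1/=.
    apply: eq_bigr => k _; rewrite (bigD1 (x k.+1))//= eqxx mul1r.
    by rewrite big1 ?addr0// => i /negbTE; rewrite eq_sym => ->; rewrite mul0r.
  by rewrite -mulrDr -big_split/=; under [in RHS]eq_bigr do rewrite subrK.
rewrite -(add0r (mean_payoff f xinf)); apply: cvgD; first exact: cesaro.
apply: (@cvg_big _ _ +%R) => [|i _]; first exact: add_continuous.
apply: cvgM; last exact: cvg_cst.
have uxS : u \o S @ \oo --> xinf by rewrite cvg_shiftS.
exact: (cvg_comp _ _ uxS (@coord_continuous _ _ _ ord0 i xinf)).
Qed.

Lemma cvg_rowP (R : realType) (n : nat) (u : nat -> 'rV[R]_n) (l : 'rV[R]_n) :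
  (forall i, (fun k => u k ord0 i) @ \oo --> l ord0 i) -> u @ \oo --> l.
Proof.
move=> ul; apply/cvgrPdist_le => e e0.
have : \forall k \near \oo, forall i, `|l ord0 i - u k ord0 i| <= e.
  by apply: filter_forall => i; move/cvgrPdist_le : (ul i); exact.
apply: filterS => k uk.
rewrite [leLHS]/Num.norm/= mx_normrE; apply/bigmax_leP.
split=> [|[j i] _]; first exact: ltW.
by rewrite (ord1 j) !mxE; exact: uk.
Qed.

(** [slln_indic] applies, for each [i], to the events that player [i] is drawn; the finitely many
    null sets are then merged. *)
Lemma iid_empirical_cvg (R : realType) (disp : measure_display)
    (Omega : measurableType disp) (P : probability Omega R) (d : nat)
    (p x0 : 'rV[R]_d.+1) (X : nat -> Omega -> 'I_d.+1) :
  iid_with_law P p (fun n => X n.+1) ->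
  {ae P, forall w, empirical_dist x0 (X ^~ w) @ \oo --> p}.
Proof.
case=> mX lawX indX.
pose A i k := X k.+1 @^-1` [set i].
have ae i : {ae P, forall w,
    (fun n => n%:R^-1 * \sum_(0 <= k < n) \1_(A i k) w) @ \oo --> p ord0 i}.
  apply: slln_indic => [k|k|j k jk]; [exact: mX|exact: lawX|].
  (* Independence over a two-element index set gives the product rule for pairs. *)
  have := indX (j |` [fset k])%fset (fun=> [set i]).
  rewrite bigcap_fset !big_fsetU1 ?inE//= !big_seq_fset1 -/(A i j) -/(A i k).
  by rewrite /A !lawX EFinM.
have : {ae P, forall w, forall i,
    (fun n => n%:R^-1 * \sum_(0 <= k < n) \1_(A i k) w) @ \oo --> p ord0 i}.
  by apply: filter_forall => i; exact: ae.
apply: filterS => w Aw.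
apply: cvg_rowP => i; apply: cvg_trans (Aw i).
apply: near_eq_cvg; near=> n.
have n0 : (0 < n)%N by near: n; exact: nbhs_infty_gt.
rewrite /empirical_dist (gtn_eqF n0) mxE big_add1/=; congr (_ * _).
apply: eq_bigr => k _; rewrite indicE; congr (nat_of_bool _)%:R.
by apply/idP/idP => [/set_mem ?|/eqP ?]; [exact/eqP|exact/mem_set].
Unshelve. all: by end_near. Qed.


Theorem theorem1 (R : realType) (d : nat) (hd : (1 <= d)%N)
    (f : 'I_d.+1 -> 'rV[R]_d.+1 -> R)
    (f_cont : forall i, {within @unit_cube R d.+1, continuous (f i)})
    (Phi : 'rV[R]_d -> R) (gradPhi : 'rV[R]_d -> 'rV[R]_d)
    (Phi_C1 :
      continuously_differentiable_on (interior (@subprob_simplex R d)) Phi)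
    (gradPhi_ext : forall v, interior (@subprob_simplex R d) v ->
      gradPhi v = gradient Phi v)
    (gradPhi_cont : {within @subprob_simplex R d, continuous gradPhi})
    (gradPhi_eq : forall v, subprob_simplex v -> forall i : 'I_d,
      gradPhi v ord0 i =
        f (lift ord0 i) (complete_prob v) - f ord0 (complete_prob v))
    (x0 : 'rV[R]_d.+1) (hx0 : prob_simplex x0) :
  (* the supremum defining Q^* is a maximum *)
  (exists2 u, prob_simplex u & mean_payoff f u = max_mean_payoff f) /\
  (forall u, prob_simplex u -> mean_payoff f u <= max_mean_payoff f) /\
  (* (1) *)
  (forall x : nat -> 'I_d.+1,
    (payoff_rate f x0 x <= (max_mean_payoff f)%:E)%E) /\
  (* (2) *)
  (forall (x : nat -> 'I_d.+1) (xinf : 'rV[R]_d.+1),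
    empirical_dist x0 x @ \oo --> xinf ->
    (fun n : nat => n%:R^-1 *
        \sum_(1 <= k < n.+1) f (x k.+1) (empirical_dist x0 x k))
      @ \oo --> mean_payoff f xinf /\
    payoff_rate f x0 x = (mean_payoff f xinf)%:E) /\
  (* (3) *)
  (forall xstar : 'rV[R]_d.+1,
    prob_simplex xstar -> mean_payoff f xstar = max_mean_payoff f ->
    forall (disp : measure_display) (Omega : measurableType disp)
      (P : probability Omega R) (X : nat -> Omega -> 'I_d.+1),
    iid_with_law P xstar (fun n => X n.+1) ->
    {ae P, forall w,
      payoff_rate f x0 (fun n => X n w) = (max_mean_payoff f)%:E}).
Proof.
have [qmax qle] := compact_max_mean_payoff hx0 f_cont.
have part2 (x : nat -> 'I_d.+1) (xinf : 'rV[R]_d.+1) :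
    empirical_dist x0 x @ \oo --> xinf ->
    payoff_rate f x0 x = (mean_payoff f xinf)%:E.
  move=> /(mean_payoff_cvg f_cont hx0) cv.
  apply: (cvg_limn_einf_sup _).1; apply: cvg_EFin => //; exact: nearW.
split=> //; split=> //.
split=> [x|]; first exact: (payoff_rate_le x (proj1 Phi_C1)
    gradPhi_ext gradPhi_cont gradPhi_eq hx0 qle).
split=> [x xinf xcv|xstar Sxstar qxstar disp Omega P X iidX]; last first.
  by apply: filterS (iid_empirical_cvg x0 iidX) => w /part2 ->; rewrite qxstar.
split; last exact: part2.
have cv := mean_payoff_cvg f_cont hx0 xcv.
pose pay k := f (x k.+1) (empirical_dist x0 x k).
rewrite -cvg_shiftS.
(* The averages in (2) run over times 1 to [n], those of [payoff_rate] over 0 to [n - 1]. After the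
   shift they differ by the factor [(n + 2) / (n + 1)], which is [1 + harmonic n], and by the term
   at time 0. *)
have -> : (fun n => n.+1%:R^-1 * \sum_(1 <= k < n.+2) pay k) = (fun n =>
    (1 + harmonic n) * (n.+2%:R^-1 * \sum_(0 <= k < n.+2) pay k)
      - harmonic n * pay 0%N).
  apply/funext => n; rewrite [in RHS]big_ltn//= -[n.+2%:R]natr1.
  set y : R := n.+1%:R; have y0 : 0 < y by [].
  field; rewrite !gt_eqF// addr_gt0//.
have -> : mean_payoff f xinf = (1 + 0) * mean_payoff f xinf - 0 * pay 0%N.
  by rewrite addr0 mul1r mul0r subr0.
apply: cvgB; last by apply: cvgM; [exact: cvg_harmonic|exact: cvg_cst].
apply: cvgM; first by apply: cvgD; [exact: cvg_cst|exact: cvg_harmonic].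
by move: cv; rewrite -cvg_shiftS -cvg_shiftS.
Qed.
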